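(* For every $k\in\mathbb{N}$ there is $\theta_k>0$ such that the following holds. Let $0<\theta<\theta_k$, $c>0$ and $\alpha>0$. For each $N$, let $p=p(N)\in(cN^{-\theta},1]$ and let $W$ be a random subset of $\mathbb{Z}_N$ in which the events $x\in W$, $x\in\mathbb{Z}_N$, are independent and each has probability $p$. Identify $\mathbb{Z}_N$ with $\{0,1,\dots,N-1\}$. Then the probability that the statement ''for every set $A\subset W$ with $|A|\geq\alpha|W|$ there exist $x,y\in A$ such that $x-y=n^k$ for some positive integer $n$'' holds is $1-o_{k,\alpha}(1)$ as $N\to\infty$.
   Context: Here $o_{k,\alpha}(1)$ denotes a quantity tending to $0$ as $N\to\infty$, at a rate that may depend on $k,\alpha$. The difference $x-y$ is the integer difference of the representatives in $\{0,\dots,N-1\}$. *)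

(* Defs.v *)
From HB Require Import structures.
From mathcomp Require Import all_boot all_order all_algebra.
From mathcomp Require Import all_classical all_reals all_analysis.
Set Implicit Arguments.
Unset Strict Implicit.
Unset Printing Implicit Defensive.
Import Order.TTheory GRing.Theory Num.Theory.
Local Open Scope classical_set_scope.
Local Open Scope ring_scope.

Definition mutually_independent (d : measure_display) (T : measurableType d)
    (R : realType) (P : probability T R) (I : finType) (E : I -> set T) : Prop :=
  (forall i, measurable (E i)) /\
  (forall S : {set I},
     P (\bigcap_(i in [set` S]) E i) = (\prod_(i in S) P (E i))%E).

(* Z_N is represented by its residues {0, ..., N - 1}, i.e. by 'I_N; the type
   'Z_N is avoided because it is not Z_N when N < 2. *)
Definition bernoulli_subset (d : measure_display) (T : measurableType d)
    (R : realType) (P : probability T R) (N : nat) (p : R)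
    (W : T -> {set 'I_N}) : Prop :=
  mutually_independent P (fun x : 'I_N => [set w | x \in W w]) /\
  (forall x : 'I_N, P [set w | x \in W w] = p%:E).

Definition power_difference_dense (R : realType) (N k : nat) (alpha : R)
    (W : {set 'I_N}) : Prop :=
  forall A : {set 'I_N}, A \subset W -> alpha * #|W|%:R <= #|A|%:R ->
    exists x y : 'I_N, [/\ x \in A, y \in A &
      exists n : nat, (0 < n)%N /\ (x : nat)%:Z - (y : nat)%:Z = n%:Z ^+ k].

(* Main.v *)
(* Dense case: let delta be the infimum of the densities that force a k-th power
   difference in some interval. A power-difference-free set of density close to
   delta > 0 has density close to delta on every long progression of step q^k,
   hence of step q; so its balanced function has small averages on progressions,
   and k - 1 van der Corput differencings carry this over to the averages along
   r^k. The number of k-th power differences is then about delta^2 times the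
   trivial count, which is absurd; so delta = 0. Averaging over the dilates
   d^k {0, ..., M - 1} upgrades this to: a dense subset of Z_N has a vertex with
   about N^(1/k) neighbours in the graph of k-th power differences.

   Sparse case: deleting such vertices one at a time bounds the independence
   polynomial of this graph at the weight lam ~ p by (1 + lam)^(eps N) (1 + s)^N
   with s/p small, as soon as p N^(1/k) is large. A first moment over the pairs
   (W, independent I in W), weighted so that every bad W contributes at least 1,
   bounds the failure probability by exp(-pN/4). *)
Require Import Defs.
From HB Require Import structures.
From mathcomp Require Import all_boot all_order all_algebra.
From mathcomp Require Import all_classical all_reals all_analysis.
From mathcomp Require Import zify ring lra.
Import Order.TTheory GRing.Theory Num.Theory.
Import numFieldNormedType.Exports.
Local Open Scope ring_scope.

(** * Van der Corput differencing in a finite abelian group *)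

Lemma sqr_sum_le (R : realFieldType) (n : nat) (a : 'I_n -> R) :
  (\sum_i a i) ^+ 2 <= n%:R * \sum_i a i ^+ 2.
Proof.
rewrite expr2 mulr_suml.
have -> : n%:R * \sum_i a i ^+ 2 =
    \sum_(i < n) \sum_(j < n) (a i ^+ 2 + a j ^+ 2) / 2.
  under [RHS]eq_bigr do rewrite -mulr_suml big_split /= sumr_const card_ord.
  rewrite -mulr_suml big_split /= sumr_const card_ord sumrMnl.
  by rewrite -[_ *+ n]mulr_natl; field.
apply: ler_sum => i _; rewrite mulr_sumr; apply: ler_sum => j _.
by have := sqr_ge0 (a i - a j); nra.
Qed.

Lemma sum_shift_le (R : realFieldType) (F : nat -> R) (L h : nat) :
  (forall r, `|F r| <= 1) ->
  `|\sum_(r < L) F r - \sum_(r < L) F (r + h)%N| <= 2 * h%:R.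
Proof.
move=> F1; elim: h => [|h IH].
  under [X in _ - X]eq_bigr do rewrite addn0.
  by rewrite subrr normr0 mulr0.
have E : \sum_(r < L) F (r + h.+1)%N = \sum_(r < L) F (r + h)%N + F (L + h)%N - F h.
  elim: L {IH} => [|L IHL]; first by rewrite !big_ord0 add0n; lra.
  by rewrite !big_ord_recr /= IHL addnS addSn; lra.
rewrite E -[h.+1]addn1 natrD.
have := F1 (L + h)%N; have := F1 h; move: IH.
by rewrite !ler_norml; lra.
Qed.

Section FiniteGroup.
Variables (R : realFieldType) (G : finZmodType) (g : G -> R).
Hypothesis g1 : forall x, `|g x| <= 1.
Let n : R := #|G|%:R.

Lemma sum_translate (F : G -> R) (v : G) : \sum_x F (x + v) = \sum_x F x.
Proof. by rewrite [RHS](reindex_inj (addIr v)). Qed.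

(* AM-GM: [2 g S <= t g^2 + S^2 / t] *)
Lemma corr_le (S : G -> R) (t : R) : 0 < t ->
  \sum_x S x ^+ 2 <= t ^+ 2 * n -> \sum_x g x * S x <= t * n.
Proof.
move=> t0 hS.
apply: (@le_trans _ _ (\sum_x (t + S x ^+ 2 / t) / 2)).
  apply: ler_sum => x _; have := g1 x; rewrite ler_norml => /andP[ga gb].
  have := sqr_ge0 (g x * t - S x) => H.
  have : g x ^+ 2 <= 1 by nra.
  move=> H2; rewrite ler_pdivlMr// -(ler_pM2r t0) mulrDl divfK ?gt_eqF//.
  by nra.
rewrite -mulr_suml big_split /= sumr_const -mulr_suml -[t *+ _]mulr_natr -/n.
rewrite ler_pdivrMr // -lerBrDl ler_pdivrMr //.
by apply: le_trans hS _; rewrite le_eqVlt; apply/orP; left; apply/eqP; ring.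
Qed.

(** Replace the sum over [r] by its average over [H] shifts, apply Cauchy-Schwarz in [r] and expand
    the square. The [H] diagonal pairs give [2 L^2 / H], the others [2 t L^2], and [8 H^2] pays for
    the ends of the shifted ranges. *)
Lemma van_der_corput (u : nat -> G) (L H : nat) (t : R) :
  (0 < H)%N -> (0 < L)%N -> 0 < t ->
  (forall h h', (h < h' < H)%N ->
     \sum_x (\sum_(r < L) g (x + (u (r + h')%N - u (r + h)%N))) ^+ 2
       <= (t * L%:R) ^+ 2 * n) ->
  \sum_x (\sum_(r < L) g (x + u r)) ^+ 2
    <= (2 * L%:R ^+ 2 / H%:R + 2 * t * L%:R ^+ 2 + 8 * H%:R ^+ 2) * n.
Proof.
move=> H0 L0 t0 hyp.
have HR : (0 : R) < H%:R by rewrite ltr0n.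
have LR : (0 : R) < L%:R by rewrite ltr0n.
pose F x r := g (x + u r).
pose V x := \sum_(r < L) \sum_(h < H) F x (r + h)%N.
have n0 : 0 <= n by rewrite ler0n.
(* Diagonal pairs get the trivial bound [L n]. For the others, removing [u (r + h)] by a translation
   leaves [g x] against the differenced sum, which [corr_le] bounds with [t L]. *)
have hC (h h' : 'I_H) :
    \sum_(r < L) \sum_x F x (r + h)%N * F x (r + h')%N
      <= (t + (h == h')%:R) * L%:R * n.
  have [<-|neq] := eqVneq h h'.
    have /le_trans : \sum_(r < L) \sum_x F x (r + h)%N * F x (r + h)%N <=
        \sum_(r < L) n.
      apply: ler_sum => r _; rewrite /n -sumr_const ler_sum // => x _.
      by have := g1 (x + u (r + h)%N); rewrite /F ler_norml => /andP[? ?]; nra.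
    apply; rewrite sumr_const card_ord -[n *+ L]mulr_natl.
    by rewrite -mulrA ler_peMl ?mulr_ge0 ?ler0n// lerDr ltW.
  wlog lt : h h' neq / (h < h')%N.
    move=> W; have [lt|lt|/val_inj e] := ltngtP h h'; first exact: W.
      have := W h' h; rewrite eq_sym => /(_ neq lt); apply: le_trans.
      apply: ler_sum => r _; apply: ler_sum => x _; by rewrite mulrC.
    by rewrite e eqxx in neq.
  rewrite /= addr0.
  have -> : \sum_(r < L) \sum_x F x (r + h)%N * F x (r + h')%N =
     \sum_x g x * \sum_(r < L) g (x + (u (r + h')%N - u (r + h)%N)).
    under [RHS]eq_bigr do rewrite mulr_sumr.
    rewrite [RHS]exchange_big /=; apply: eq_bigr => r _.
    rewrite -[RHS](sum_translate _ (u (r + h)%N)); apply: eq_bigr => x _.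
    by rewrite /F -addrA [u (r + h)%N + _]addrC subrK.
  apply: corr_le; first exact: mulr_gt0.
  by apply: hyp; rewrite lt ltn_ord.
have hV : \sum_x V x ^+ 2 <= (H%:R * L%:R ^+ 2 + t * H%:R ^+ 2 * L%:R ^+ 2) * n.
  apply: (@le_trans _ _ (L%:R * \sum_(h < H) \sum_(h' < H)
      \sum_(r < L) \sum_x F x (r + h)%N * F x (r + h')%N)).
    apply: (@le_trans _ _ (\sum_x L%:R * \sum_(r < L) (\sum_(h < H) F x (r + h)%N) ^+ 2)).
      by apply: ler_sum => x _; exact: sqr_sum_le.
    rewrite -mulr_sumr ler_pM2l // le_eqVlt; apply/orP; left; apply/eqP.
    under [RHS]eq_bigr do rewrite exchange_big /=.
    rewrite [RHS]exchange_big /= exchange_big /=; apply: eq_bigr => r _.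
    under [RHS]eq_bigr do rewrite exchange_big /=.
    rewrite [RHS]exchange_big /=; apply: eq_bigr => x _.
    rewrite expr2 mulr_suml; apply: eq_bigr => h _; by rewrite mulr_sumr.
  have -> : (H%:R * L%:R ^+ 2 + t * H%:R ^+ 2 * L%:R ^+ 2) * n =
     L%:R * \sum_(h < H) \sum_(h' < H) (t + (h == h')%:R) * L%:R * n.
    have E (h : 'I_H) : \sum_(h' < H) (t + (h == h')%:R) * L%:R * n =
        (H%:R * t + 1) * L%:R * n.
      rewrite -!mulr_suml big_split /= sumr_const card_ord (bigD1 h) //= eqxx.
      rewrite big1 ?addr0 ?mulr_natl // => i; rewrite eq_sym => /negbTE -> //.
    under eq_bigr do rewrite E.
    by rewrite sumr_const card_ord -mulr_natl; ring.
  by rewrite ler_pM2l //; apply: ler_sum => h _; apply: ler_sum => h' _; exact: hC.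
(* The shifts cost at most [2 H^2] altogether, so [(H S)^2 <= 2 V^2 + 2 (2 H^2)^2]. *)
have hS x : H%:R ^+ 2 * (\sum_(r < L) F x r) ^+ 2 <= 2 * V x ^+ 2 + 8 * H%:R ^+ 4.
  have : `|H%:R * \sum_(r < L) F x r - V x| <= 2 * H%:R ^+ 2.
    rewrite /V exchange_big /=.
    have -> : H%:R * \sum_(r < L) F x r = \sum_(h < H) \sum_(r < L) F x r.
      by rewrite sumr_const card_ord mulr_natl.
    rewrite -sumrB; apply: (le_trans (ler_norm_sum _ _ _)).
    have -> : 2 * H%:R ^+ 2 = \sum_(h < H) 2 * H%:R :> R.
      by rewrite sumr_const card_ord -[RHS]mulr_natl; ring.
    apply: ler_sum => h _; apply: (le_trans (sum_shift_le _ _ _ _ _)).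
      by move=> r; exact: g1.
    by rewrite ler_pM2l // ler_nat ltnW.
  set S := \sum_(r < L) _; set c := H%:R ^+ 2 => hn.
  have c0 : 0 <= c by exact: sqr_ge0.
  have e4 : H%:R ^+ 4 = c ^+ 2 by rewrite /c -exprM.
  have : (H%:R * S - V x) ^+ 2 <= (2 * c) ^+ 2.
    by rewrite -[leLHS]real_normK ?num_real // lerXn2r // nnegrE mulr_ge0.
  rewrite e4 /c; move: c {hn c0 e4} => c.
  have := sqr_ge0 (H%:R * S - 2 * V x).
  by nra.
rewrite -(ler_pM2l (_ : 0 < H%:R ^+ 2)); last by rewrite exprn_gt0.
rewrite mulr_sumr; apply: (@le_trans _ _ (\sum_x (2 * V x ^+ 2 + 8 * H%:R ^+ 4))).
  by apply: ler_sum => x _; exact: hS.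
rewrite big_split /= sumr_const -mulr_sumr -[_ *+ #|G|]mulr_natr -/n.
have -> : H%:R ^+ 2 * ((2 * L%:R ^+ 2 / H%:R + 2 * t * L%:R ^+ 2 + 8 * H%:R ^+ 2) * n)
  = 2 * ((H%:R * L%:R ^+ 2 + t * H%:R ^+ 2 * L%:R ^+ 2) * n) + 8 * H%:R ^+ 4 * n.
  by field; rewrite gt_eqF.
by rewrite lerD2r ler_pM2l.
Qed.

End FiniteGroup.

(** * Uniformity along polynomial sequences *)

(* [f] behaves like a polynomial of degree [d.+1] whose leading coefficient
   is [q / d.+1!]. *)
Fixpoint poly_like (d : nat) (q : int) (f : nat -> int) : Prop :=
  if d is d'.+1 then
    forall h h' : nat, (h < h')%N ->
      poly_like d' (q * (h'%:Z - h%:Z)) (fun r => f (r + h')%N - f (r + h)%N)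
  else forall r : nat, f r = f 0%N + q * r%:Z.

Lemma poly_like_sum (d n : nat) (q : 'I_n -> int) (f : 'I_n -> nat -> int) (c : 'I_n -> int) :
  (forall i, poly_like d (q i) (f i)) ->
  poly_like d (\sum_i c i * q i) (fun r => \sum_i c i * f i r).
Proof.
elim: d q f => [|d IH] q f H /=.
  move=> r; rewrite mulr_suml -big_split /=; apply: eq_bigr => i _.
  by rewrite [f i r]H mulrDr mulrA.
move=> h h' lt; rewrite mulr_suml.
under eq_bigr do rewrite -mulrA.
rewrite [X in poly_like _ _ X](_ : _ =
    fun r => \sum_i c i * (f i (r + h')%N - f i (r + h)%N)); last first.
  by apply/funext => r; rewrite -sumrB; apply: eq_bigr => i _; rewrite mulrBr.
by apply: IH => i; exact: H.
Qed.

(** By the binomial theorem a difference of [r^j] is a combination of lower powers. Only the top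
    one, with coefficient [j (h' - h)], affects the leading coefficient, which builds up the
    factorial. Smaller [j], with leading coefficient 0, are included because the lower powers come
    up in the induction. *)
Lemma poly_like_expn (d j : nat) : (j <= d.+1)%N ->
  poly_like d ((d.+1)`!%:Z *+ (j == d.+1)) (fun r => (r ^ j)%N%:Z).
Proof.
elim: d j => [|d IH] j.
  by case: j => [|[|]] //= _ r; rewrite ?expn0 ?expn1 ?expn0 ?mulr0n ?mulr1n ?mul0r ?mul1r ?addr0 ?add0r.
have PoszX (m n : nat) : (m ^ n)%N%:Z = m%:Z ^+ n by rewrite -!natz natrX.
move=> jd h h' lt /=.
pose c (i : 'I_j) : int := 'C(j, i)%:Z * (h'%:Z ^+ (j - i) - h%:Z ^+ (j - i)).
have -> : (fun r => ((r + h') ^ j)%N%:Z - ((r + h) ^ j)%N%:Z) =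
    (fun r => \sum_(i < j) c i * (r ^ i)%N%:Z).
  apply/funext => r.
  have E (t : nat) : ((r + t) ^ j)%N%:Z =
      (r ^ j)%N%:Z + \sum_(i < j) 'C(j, i)%:Z * t%:Z ^+ (j - i) * (r ^ i)%N%:Z.
    rewrite !PoszX PoszD addrC exprDn big_ord_recr /=.
    rewrite subnn expr0 mul1r binn mulr1n addrC; congr (_ + _).
    by apply: eq_bigr => i _; rewrite PoszX -mulr_natl natz; ring.
  rewrite !E opprD addrACA subrr add0r -sumrB; apply: eq_bigr => i _.
  by rewrite /c; ring.
have -> : (d.+2)`!%:Z *+ (j == d.+2) * (h'%:Z - h%:Z) =
   \sum_(i < j) c i * ((d.+1)`!%:Z *+ (i == d.+1 :> nat)).
  have [e|neq] := eqVneq j d.+2; last first.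
    rewrite mulr0n mul0r big1 // => i _.
    have /negbTE -> : i != d.+1 :> nat by have := ltn_ord i; lia.
    by rewrite mulr0n mulr0.
  subst j; rewrite big_ord_recr /= big1 => [|i _]; last first.
    by rewrite (_ : (i == d.+1 :> nat) = false) ?mulr0 //; have := ltn_ord i; lia.
  rewrite eqxx !mulr1n add0r /c /= subSnn !expr1 binSn.
  by rewrite factS PoszM; ring.
by apply: poly_like_sum => i; apply: IH; have := ltn_ord i; lia.
Qed.

(** Each differencing lowers the degree and multiplies the leading coefficient by [h' - h < H]; in
    the end only progressions with steps at most [Q'] are left. All constants are fixed before [G],
    [g] and [f]. *)
Lemma poly_uniform (R : realType) (d Q : nat) (e : R) : 0 < e ->
  exists Q' L0 : nat, exists2 eta : R, 0 < eta &
  forall (G : finZmodType) (g : G -> R) (a : G) (L : nat),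
    (L0 <= L)%N -> (forall x, `|g x| <= 1) ->
    (forall q, (0 < q <= Q')%N ->
      \sum_x `|\sum_(r < L) g (x + a *+ (q * r))| <= eta * L%:R * #|G|%:R) ->
    forall (f : nat -> int) (q : nat), (0 < q <= Q)%N -> poly_like d q%:Z f ->
    \sum_x (\sum_(r < L) g (x + a *~ f r)) ^+ 2 <= e * L%:R ^+ 2 * #|G|%:R.
Proof.
elim: d Q e => [|d IH] Q e e0.
  exists Q, 0%N, e => // G g a L _ g1 hyp f q qQ hf.
  have /= {}hf : forall r : nat, f r = f 0%N + q%:Z * r%:Z := hf.
  (* The constant term [f 0] disappears by translation; one factor of the square is then bounded by
     [L]. *)
  pose S x := \sum_(r < L) g (x + a *+ (q * r)).
  have -> : \sum_x (\sum_(r < L) g (x + a *~ f r)) ^+ 2 = \sum_x S x ^+ 2.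
    rewrite -[RHS](sum_translate _ _ _ (a *~ f 0%N)); apply: eq_bigr => x _.
    congr (_ ^+ 2); apply: eq_bigr => r _.
    by rewrite hf mulrzDr addrA -PoszM.
  have hS x : S x ^+ 2 <= L%:R * `|S x|.
    rewrite -real_normK ?num_real // expr2 ler_wpM2r //.
    apply: (le_trans (ler_norm_sum _ _ _)).
    rewrite -[L in L%:R]card_ord -sumr_const; exact: ler_sum.
  apply: (@le_trans _ _ (\sum_x L%:R * `|S x|)).
    by apply: ler_sum => x _; exact: hS.
  rewrite -mulr_sumr.
  have -> : e * L%:R ^+ 2 * #|G|%:R = L%:R * (e * L%:R * #|G|%:R) by ring.
  by apply: ler_wpM2l => //; exact: hyp.
(* With this [H], [t = e / 6] and [L >= 2 H^2], each of the three terms of [van_der_corput] is at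
   most [e / 3 * L^2]. *)
pose H := (Num.truncn (6 / e)).+1.
have eH : 6 <= e * H%:R.
  by rewrite mulrC -ler_pdivrMr // ltW // truncnS_gt.
have HR : (0 : R) < H%:R by rewrite ltr0n.
have H0 : (0 < H)%N by [].
have e6 : 0 < e / 6 by rewrite divr_gt0.
have [Q' [L0 [eta eta0 hyp]]] := IH (Q * H)%N ((e / 6) ^+ 2) (exprn_gt0 _ e6).
exists Q', (maxn L0 (2 * H ^ 2))%N, eta => // G g a L.
rewrite geq_max => /andP[LL0 LH] g1 hg f q qQ hf.
have L_gt0 : (0 < L)%N by apply: leq_trans LH; rewrite muln_gt0 expn_gt0.
apply: le_trans (van_der_corput _ _ _ g1 (fun r => a *~ f r) L H (e / 6) H0 L_gt0 e6 _) _.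
  move=> h h' /andP[hh' h'H].
  rewrite exprMn; under eq_bigr do under eq_bigr do rewrite -mulrzBr.
  apply: (hyp G g a L LL0 g1 hg (fun r => f (r + h')%N - f (r + h)%N) (q * (h' - h))%N).
    by rewrite muln_gt0 subn_gt0 hh'; case/andP: qQ => -> qQ; rewrite leq_mul //; lia.
  have := hf h h' hh'; by rewrite PoszM -subzn // ltnW.
apply: ler_wpM2r => //.
have lR : 2 * (H%:R : R) ^+ 2 <= L%:R by rewrite -natrX -natrM ler_nat.
have : 2 * L%:R ^+ 2 / H%:R <= e / 3 * L%:R ^+ 2.
  rewrite ler_pdivrMr //; have : (0 : R) <= L%:R ^+ 2 by exact: sqr_ge0.
  by nra.
have : 8 * H%:R ^+ 2 <= e / 3 * L%:R ^+ 2.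
  have H1 : 1 <= (H%:R : R) by rewrite ler1n.
  have : (2 * (H%:R : R) ^+ 2) ^+ 2 <= L%:R ^+ 2.
    by rewrite lerXn2r // ?nnegrE ?mulr_ge0 ?sqr_ge0.
  move: (L%:R ^+ 2) => l hl.
  apply: le_trans (_ : e / 3 * (2 * H%:R ^+ 2) ^+ 2 <= _); last first.
    by rewrite ler_pM2l // divr_gt0.
  have -> : e / 3 * (2 * H%:R ^+ 2) ^+ 2 = 4 / 3 * (e * H%:R) * H%:R * H%:R ^+ 2 by field.
  rewrite ler_wpM2r ?sqr_ge0 //; nra.
by lra.
Qed.

(** * The density of sets without k-th power differences *)

(** The factor [t] serves restriction to progressions: along one of step [q], freeness for [t = 1]
    becomes freeness for [t = q^(k-1)]. *)
Definition power_free (k t : nat) (A : pred nat) : Prop :=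
  forall x n : nat, (0 < n)%N -> A x -> ~~ A (x + t * n ^ k)%N.

Lemma sum_ord_mul (a b : nat) (F : nat -> nat) :
  (\sum_(i < a * b) F i = \sum_(i < a) \sum_(j < b) F (i * b + j))%N.
Proof.
rewrite -(big_mkord xpredT) big_nat_mul big_mkord; apply: eq_bigr => i _.
rewrite -{1}[(i * b)%N]add0n big_addn mulSn addnK big_mkord.
by apply: eq_bigr => j _; rewrite addnC.
Qed.

Lemma sum_tail_le (m c T : nat) : (\sum_(x < m) (T <= x + c) <= m + c - T)%N.
Proof.
elim: m => [|m IH]; first by rewrite big_ord0.
rewrite big_ord_recr /=; move: IH; move: (\sum_(_ < _) _)%N => S IH.
by case: leqP => /= H; lia.
Qed.

Section DensityBound.
Variables (R : realType) (k M : nat) (d : R).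
Hypotheses (M0 : (0 < M)%N) (d0 : 0 <= d).
Hypothesis dM : forall A, power_free k 1 A -> (\sum_(i < M) A i)%N%:R <= d * M%:R.

(** Cover the range by blocks of length [M t] and split each into residue classes modulo [t]. On a
    class, differences [t n^k] become [n^k], so [dM] applies. Rounding up to whole blocks costs at
    most [t M]. *)
Lemma power_free_count (t L : nat) (A : pred nat) : (0 < t)%N ->
  power_free k t A -> (\sum_(i < L) A i)%N%:R <= d * (L + t * M)%:R.
Proof.
move=> t0 At.
pose J := (L %/ (M * t)).+1.
have Mt0 : (0 < M * t)%N by rewrite muln_gt0 M0.
have LJ : (L <= J * (M * t))%N by rewrite ltnW // ltn_ceil.
apply: (@le_trans _ _ (\sum_(i < J * (M * t)) A i)%N%:R).
  by rewrite ler_nat -!(big_mkord xpredT (fun i => A i : nat)) [leqRHS](big_cat_nat (n := L)) //= leq_addr.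
rewrite (sum_ord_mul _ _ (fun i => A i : nat)).
apply: (@le_trans _ _ (d * (J * t * M)%:R)); last first.
  apply: ler_wpM2l => //; rewrite ler_nat /J mulSn.
  by have := leq_trunc_div L (M * t); nia.
rewrite natr_sum -mulnA natrM mulrCA -[J in J%:R]card_ord mulr_natl -sumr_const.
apply: ler_sum => j _; rewrite (sum_ord_mul _ _ (fun i => A (j * (M * t) + i)%N : nat)) exchange_big /= natr_sum.
rewrite natrM mulrCA -[t in t%:R]card_ord mulr_natl -sumr_const.
apply: ler_sum => c _.
apply: (dM (fun i => A (j * (M * t) + (i * t + c))%N)) => x n n0 Ax.
have := At _ _ n0 Ax; rewrite mul1n.
by congr (~~ A _); ring.
Qed.

End DensityBound.

Lemma val_addZp (n v : nat) (x : 'I_n.+1) :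
  x + (inZp 1 : 'I_n.+1) *+ v = ((x + v) %% n.+1)%N :> nat.
Proof. by rewrite Zp_mulrn /= modnMml mul1n modnDmr. Qed.

Section Cyclic.
Variables (R : realType) (k n : nat) (A : pred nat).
Hypotheses (k0 : (0 < k)%N) (Afree : power_free k 1 A).
Local Notation N := n.+1.
Let dens : R := (\sum_(i < N) A i)%N%:R / N%:R.
Let g (x : 'I_N) : R := (A x)%:R - dens.

Lemma dens_itv : 0 <= dens <= 1.
Proof.
rewrite divr_ge0 //= ler_pdivrMr ?ltr0n // mul1r ler_nat.
by apply: leq_trans (leq_sum _ (_ : forall i : 'I_N, _ -> A i <= 1))%N _;
  rewrite ?sum_nat_const ?card_ord ?muln1 // => i _; case: (A i).
Qed.

Lemma balanced_le1 x : `|g x| <= 1.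
Proof.
by have /andP[? ?] := dens_itv; rewrite /g ler_norml; case: (A x) => /=; apply/andP; lra.
Qed.

Lemma sum_balanced : \sum_x g x = 0.
Proof.
rewrite /g sumrB sumr_const card_ord -natr_sum -[X in _ - X]mulr_natl mulrC divfK ?subrr //.
Qed.

(* Nearly extremal sets are uniform on progressions: the upper bound [B] on
   every progression and the vanishing mean bound the negative part too. *)
Lemma progression_uniform (M : nat) (d B : R) (q L : nat) :
  (0 < M)%N -> 0 <= d ->
  (forall A, power_free k 1 A -> (\sum_(i < M) A i)%N%:R <= d * M%:R) ->
  (0 < q)%N -> 0 <= B -> d * (L + q ^ k.-1 * M)%:R - dens * L%:R <= B ->
  \sum_x `|\sum_(r < L) g (x + inZp 1 *+ (q * r))| <=
    2 * (N%:R * B + L%:R * (q * L)%:R).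
Proof.
move=> M0 d0 dM q0 B0 hB.
pose S x := \sum_(r < L) g (x + inZp 1 *+ (q * r)).
have S0 : \sum_x S x = 0.
  rewrite /S exchange_big big1 //= => r _.
  by rewrite (sum_translate _ _ g) sum_balanced.
(* The indicator marks the starting points whose progression may wrap around modulo [N]. Only the
   trivial bound [L] is used there, but there are at most [q L] of them. *)
have SB (x : 'I_N) : S x <= B + L%:R * (N <= x + q * L)%N%:R.
  have [hx|hx] := leqP N (x + q * L)%N.
    rewrite mulr1; apply: (@le_trans _ _ (L%:R)); last by rewrite lerDr.
    rewrite -[L in L%:R]card_ord -sumr_const; apply: ler_sum => r _.
    by have := balanced_le1 (x + inZp 1 *+ (q * r)); rewrite ler_norml => /andP[].
  rewrite mulr0 addr0; apply: le_trans hB.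
  rewrite /S /g sumrB sumr_const card_ord -[X in _ - X]mulr_natr lerD2r -natr_sum.
  rewrite (eq_bigr (fun r : 'I_L => A (x + q * r)%N : nat)); last first.
    move=> r _; rewrite val_addZp modn_small //; apply: leq_ltn_trans hx.
    by rewrite leq_add2l leq_mul2l ltnW ?orbT.
  apply: (power_free_count _ k M d M0 d0 dM (q ^ k.-1) L (fun r => A (x + q * r)%N)).
    by rewrite expn_gt0 q0.
  move=> r m m0 Ar; have := Afree _ (q * m) _ Ar.
  rewrite muln_gt0 q0 m0 mul1n => /(_ isT); congr (~~ A _).
  by rewrite mulnDr addnA expnMn -[in (q ^ k)%N](prednK k0) expnS; ring.
(* If [S <= C] and [C >= 0] then [|S| <= 2 C - S], and the last term sums to 0. *)
have abs (x : 'I_N) : `|S x| <= 2 * (B + L%:R * (N <= x + q * L)%N%:R) - S x.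
  have := SB x; have : 0 <= B + L%:R * (N <= x + q * L)%N%:R by rewrite addr_ge0 ?mulr_ge0.
  by move: (B + _) => C ? ?; rewrite ler_norml; apply/andP; lra.
apply: (le_trans (ler_sum _ (fun x _ => abs x))).
rewrite sumrB S0 subr0 -mulr_sumr ler_pM2l // big_split /= sumr_const card_ord.
rewrite -[B *+ _]mulr_natl lerD2l -mulr_sumr ler_wpM2l // -natr_sum ler_nat.
by apply: leq_trans (sum_tail_le _ _ _) _; rewrite addKn.
Qed.

(** Count the pairs [x], [x + r^k] modulo [N] inside [A] in two ways. Power-freeness leaves only
    [r = 0] and the pairs that wrap around; on the other side, [A] is its density plus [g], and the
    correlations of [g] are small on average. *)
Lemma pair_count (t : R) (L : nat) : 0 < t -> (0 < L)%N ->
  \sum_x (\sum_(r < L) g (x + inZp 1 *+ (r ^ k))) ^+ 2 <= (t * L%:R) ^+ 2 * N%:R ->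
  L%:R * dens ^+ 2 * N%:R <= N%:R + L%:R * L%:R ^+ k + t * L%:R * N%:R.
Proof.
move=> t0 L0 hS.
have LR : (0 : R) < L%:R by rewrite ltr0n.
pose C v : R := \sum_(x < N) (A x)%:R * (A (x + inZp 1 *+ v)%R)%:R.
have CE v : C v = \sum_x g x * g (x + inZp 1 *+ v) + dens ^+ 2 * N%:R.
  transitivity (\sum_x (g x * g (x + inZp 1 *+ v) + dens * g x +
                        dens * g (x + inZp 1 *+ v) + dens ^+ 2)).
    by apply: eq_bigr => x _; rewrite /g; ring.
  rewrite !big_split /= sumr_const card_ord -[_ ^+ 2 *+ _]mulr_natr -!mulr_sumr.
  by rewrite sum_balanced (sum_translate _ _ g) sum_balanced !mulr0 !addr0.
have up : \sum_(r < L) C (r ^ k)%N <= N%:R + L%:R * L%:R ^+ k.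
  apply: (@le_trans _ _ (\sum_(r < L) ((r == 0 :> nat)%:R * N%:R + L%:R ^+ k))).
    apply: ler_sum => r _; rewrite -natrX.
    apply: (@le_trans _ _ (\sum_(x < N) ((r == 0 :> nat) + (N <= x + r ^ k))%N%:R)).
      apply: ler_sum => x _; rewrite -natrM ler_nat val_addZp.
      have [r0|r0] := posnP r; first by case: (A x); case: (A _).
      have [hx|hx] := leqP N (x + r ^ k)%N; first by case: (A x); case: (A _).
      rewrite modn_small //; have [Ax|//] := boolP (A x).
      by have /negbTE := Afree x r r0 Ax; rewrite mul1n => ->.
    rewrite -natr_sum -natrM -natrD ler_nat big_split /= sum_nat_const card_ord.
    rewrite mulnC leq_add2l; apply: leq_trans (sum_tail_le _ _ _) _.
    by rewrite addKn leq_exp2r // ltnW.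
  rewrite big_split /= sumr_const card_ord -[X in _ + X]mulr_natl lerD2r.
  rewrite -mulr_suml ler_piMl // (bigD1 (Ordinal L0)) //= big1 ?addr0 // => i.
  by rewrite -val_eqE /= => /negbTE ->.
(* [corr_le] is an upper bound, so it is applied to the negated sum. *)
have lo : - (t * L%:R * N%:R) <= \sum_x g x * \sum_(r < L) g (x + inZp 1 *+ (r ^ k)).
  rewrite lerNl -sumrN; under eq_bigr do rewrite -mulrN.
  have := corr_le _ _ g balanced_le1
    (fun x => - \sum_(r < L) g (x + inZp 1 *+ (r ^ k))) (t * L%:R) (mulr_gt0 t0 LR).
  by rewrite card_ord; apply; under eq_bigr do rewrite sqrrN.
have : \sum_(r < L) C (r ^ k)%N = L%:R * dens ^+ 2 * N%:R +
    \sum_x g x * \sum_(r < L) g (x + inZp 1 *+ (r ^ k)).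
  under eq_bigr do rewrite CE.
  rewrite big_split /= sumr_const card_ord -[X in _ + X]mulr_natl mulrA addrC; congr (_ + _).
  rewrite exchange_big /=; apply: eq_bigr => x _; by rewrite mulr_sumr.
by lra.
Qed.

End Cyclic.

Lemma sarkozy (R : realType) (k b : nat) : (0 < k)%N -> (0 < b)%N ->
  exists2 M : nat, (0 < M)%N &
    forall A, power_free k 1 A -> (b * \sum_(i < M) A i <= M)%N.
Proof.
move=> k0 b0.
pose D := [set d : R | 0 <= d /\ exists2 M : nat, (0 < M)%N &
  forall A, power_free k 1 A -> (\sum_(i < M) A i)%N%:R <= d * M%:R]%classic.
have D1 : D 1.
  split=> //; exists 1%N => // A _; rewrite big_ord_recl big_ord0 addn0 mul1r ler_nat.
  by case: (A _).
have D_inf : has_inf D by split; [exists 1 | exists 0 => d []].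
pose delta := inf D.
have delta_le1 : delta <= 1 by apply: ge_inf => //; case: D_inf.
have delta_ge0 : 0 <= delta by apply: lb_le_inf => [|d []//]; exists 1.
have [delta0|delta_gt0] := leP delta 0.
  have bR : (0 : R) < b%:R by rewrite ltr0n.
  have [|d [d0 [M M0 dM]] hd] := @inf_adherent R D b%:R^-1 _ D_inf.
    by rewrite invr_gt0.
  exists M => // A /dM hA; rewrite -(ler_nat R) natrM.
  rewrite -ler_pdivlMl //; apply: le_trans hA _; apply: ler_wpM2r => //.
  by apply: le_trans (ltW hd) _; rewrite -/delta; lra.
exfalso.
(* Write [N] for [n.+1]. As [dens >= delta / 2], the main term of [pair_count] is at least
   [delta^2 / 4 * L * N]; subtracting [t L N] leaves at least [3 N], because [delta^2 * L >= 16],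
   against the upper bound [2 N]. *)
pose t := delta ^+ 2 / 16.
have t0 : 0 < t by rewrite divr_gt0 // exprn_gt0.
have [Q [L0 [eta0 eta0_gt0 hunif]]] := poly_uniform R k.-1 k`! _ (exprn_gt0 2 t0).
(* The first bound absorbs the loss [2 (3 eta + eta) L N] from [progression_uniform]; the second
   keeps [delta - eta >= delta / 2]. *)
pose eta := Num.min (eta0 / 8) (delta / 2).
have eta_gt0 : 0 < eta by rewrite lt_min !divr_gt0.
have eta_le1 : eta <= eta0 / 8 by rewrite ge_min lexx.
have eta_le2 : eta <= delta / 2 by rewrite ge_min lexx orbT.
have [d [d0 [M M0 dM]] hd] := @inf_adherent R D eta eta_gt0 D_inf.
pose t0' := (Q ^ k.-1)%N.
(* [L] is chosen after [M], and [n] after [L]: a large [L] makes the block rounding and the pairs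
   with [r = 0] negligible, a large [n] the wraparound. *)
pose L := (maxn L0 (maxn (Num.truncn ((2 * t0' * M)%:R / eta)) (Num.truncn (16 / delta ^+ 2)))).+1.
have LL0 : (L0 <= L)%N by rewrite leqW // leq_max leqnn.
have LM : (2 * t0' * M)%:R <= eta * L%:R.
  rewrite mulrC -ler_pdivrMr //; apply: le_trans (ltW (truncnS_gt _)) _.
  by rewrite ler_nat ltnS !leq_max leqnn orbT.
have Ldelta : 16 <= delta ^+ 2 * L%:R.
  rewrite mulrC -ler_pdivrMr ?exprn_gt0 //; apply: le_trans (ltW (truncnS_gt _)) _.
  by rewrite ler_nat ltnS !leq_max leqnn !orbT.
have LR : (0 : R) < L%:R by rewrite ltr0n.
pose n := maxn (Num.truncn ((Q * L)%:R / eta)) (L * L ^ k)%N.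
have NQ : (Q * L)%:R <= eta * n.+1%:R.
  rewrite mulrC -ler_pdivrMr //; apply: le_trans (ltW (truncnS_gt _)) _.
  by rewrite ler_nat ltnS !leq_max leqnn.
have NL : L%:R * L%:R ^+ k <= n.+1%:R :> R.
  by rewrite -natrX -natrM ler_nat leqW // leq_max leqnn orbT.
have NR : (0 : R) < n.+1%:R by rewrite ltr0n.
(* [delta - eta] is nonnegative and below the infimum, so it is not in [D]; in particular it fails
   for the length [n.+1]. *)
have [A Afree hA] : exists2 A, power_free k 1 A &
    (delta - eta) * n.+1%:R < (\sum_(i < n.+1) A i)%N%:R.
  apply: contrapT => hno.
  have : D (delta - eta).
    split; first by lra.
    exists n.+1 => // A Af; rewrite leNgt; apply/negP => h; apply: hno; by exists A.
  by move=> /(ge_inf (proj2 D_inf)); rewrite -/delta; lra.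
pose dens : R := (\sum_(i < n.+1) A i)%N%:R / n.+1%:R.
have dens_gt : delta - eta < dens by rewrite ltr_pdivlMr.
have := pair_count R k n A k0 Afree t L t0 isT.
have := hunif 'I_n.+1 (fun x => (A x)%:R - dens) (inZp 1) L LL0
  (balanced_le1 R n A).
rewrite card_ord => /(_ _ (fun r => (r ^ k)%N%:Z) k`!) => unif pc.
have {}pc := pc (le_trans (unif _ _ _) _).
have : L%:R * dens ^+ 2 * n.+1%:R <= n.+1%:R + L%:R * L%:R ^+ k + t * L%:R * n.+1%:R.
  apply: pc.
  - move=> q /andP[q0 qQ].
    have qQk : (q ^ k.-1 <= t0')%N.
      by rewrite /t0'; case: k.-1 => // m; rewrite leq_exp2r.
    (* Of [3 eta L], [2 eta L] bounds [(d - dens) L] and [eta L] the block rounding, where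
       [d <= 2]. *)
    have B0 : 0 <= 3 * eta * L%:R by rewrite !mulr_ge0 // ltW.
    apply: le_trans (progression_uniform R k n A k0 Afree M d (3 * eta * L%:R) q L M0 d0 dM q0 B0 _) _.
      rewrite -/dens natrD mulrDr.
      have : d * (q ^ k.-1 * M)%:R <= eta * L%:R.
        apply: le_trans LM; apply: (@le_trans _ _ (2 * (t0' * M)%:R)).
          apply: ler_pM => //; first by rewrite /delta in delta_le1 eta_le2; lra.
          by rewrite ler_nat leq_mul2r qQk orbT.
        by rewrite -natrM mulnA.
      have : (d - dens) * L%:R <= 2 * eta * L%:R.
        by rewrite ler_pM2r // -/delta in hd *; lra.
      by lra.
    have : L%:R * (q * L)%:R <= L%:R * (eta * n.+1%:R).
      rewrite ler_pM2l //; apply: le_trans NQ; by rewrite ler_nat leq_mul2r qQ orbT.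
    have : 8 * eta * (L%:R * n.+1%:R) <= eta0 * (L%:R * n.+1%:R).
      by rewrite ler_pM2r ?mulr_gt0 //; lra.
    by lra.
  - by rewrite fact_gt0 leqnn.
  - by have := poly_like_expn k.-1 k; rewrite (prednK k0) eqxx mulr1n; apply.
  - by rewrite -exprMn.
have dens2 : delta ^+ 2 / 4 <= dens ^+ 2.
  have -> : delta ^+ 2 / 4 = (delta / 2) ^+ 2 by field.
  by apply: lerXn2r; rewrite ?nnegrE; lra.
have : L%:R * (delta ^+ 2 / 4) * n.+1%:R <= L%:R * dens ^+ 2 * n.+1%:R.
  by rewrite ler_pM2r // ler_pM2l.
rewrite /t => h1 h2.
have : L%:R * (delta ^+ 2 / 4) * n.+1%:R <= (2 + delta ^+ 2 / 16 * L%:R) * n.+1%:R.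
  by lra.
rewrite ler_pM2r //; lra.
Qed.

(** * Vertices of large degree in the graph of k-th power differences *)

Definition power_adj (k N : nat) : rel 'I_N := fun x y =>
  `[< exists n, (0 < n)%N /\ (y = x + n ^ k :> nat \/ x = y + n ^ k :> nat)%N >].

Lemma sum_pred_shift_ge (A : pred nat) (N c : nat) :
  (\sum_(a < N) A a <= c + \sum_(a < N) A (a + c))%N.
Proof.
elim: c => [|c IH]; first by rewrite add0n leq_sum // => i _; rewrite addn0.
apply: leq_trans IH _; rewrite addSnnS leq_add2l.
have := big_ord_recl N (fun a => A (a + c)%N : nat) (op := addn) (idx := 0%N).
have := big_ord_recr N (fun a => A (a + c)%N : nat) (op := addn) (idx := 0%N).
rewrite /= => -> /=.
under [X in _ = (_ + X)%N -> _]eq_bigr do rewrite /bump addSnnS.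
by case: (A (0 + c)%N); case: (A (N + c)%N) => /=; lia.
Qed.

Lemma sum_shift_le_supp (F : nat -> nat) (N c : nat) :
  (forall x, (N <= x)%N -> F x = 0%N) ->
  (\sum_(a < N) F (a + c) <= \sum_(a < N) F a)%N.
Proof.
move=> F0; elim: c => [|c]; first by rewrite leq_sum // => i _; rewrite addn0.
apply: leq_trans.
have := big_ord_recl N (fun a => F (a + c)%N) (op := addn) (idx := 0%N).
have := big_ord_recr N (fun a => F (a + c)%N) (op := addn) (idx := 0%N).
rewrite /= F0 ?leq_addr // addn0 => ->.
under [X in _ = (_ + X)%N -> _]eq_bigr do rewrite /bump addSnnS.
by move=> ->; rewrite leq_addl.
Qed.

(** Either the dilate meets [A] in density at most [1 / (4 b)], or it contains a pair at distance
    [(t n)^k] with [n <= M]; one such pair already pays for the trivial count [M]. *)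
Lemma dilate_count (k b M : nat) (A : pred nat) (a t : nat) : (0 < k)%N ->
  (forall A, power_free k 1 A -> (4 * b * \sum_(i < M) A i <= M)%N) ->
  (4 * b * \sum_(i < M) A (a + t ^ k * i) <=
    M + 4 * b * M * \sum_(i < M) \sum_(n < M)
      (A (a + t ^ k * i) && A (a + t ^ k * i + (t * n.+1) ^ k)))%N.
Proof.
move=> k0 HM; pose E i := (i < M)%N && A (a + t ^ k * i)%N.
have sE : (\sum_(i < M) A (a + t ^ k * i) = \sum_(i < M) E i)%N.
  by apply: eq_bigr => i _; rewrite /E ltn_ord.
have [/HM|] := pselect (power_free k 1 E); first by rewrite sE; lia.
move=> /existsNP[x] /existsNP[n] /not_implyP[n0] /not_implyP[Ex] /negP.
rewrite negbK mul1n => Ey.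
have /andP[xM Ax] := Ex; have /andP[yM Ay] := Ey.
have nk : (n <= n ^ k)%N by rewrite -{1}[n]expn1 leq_pexp2l.
have nM : (n.-1 < M)%N by lia.
apply: leq_trans (leq_addl _ _); rewrite -[leqRHS]mulnA leq_mul2l; apply/orP; right.
apply: (@leq_trans M).
  rewrite sE; apply: leq_trans (leq_sum _ (_ : forall i : 'I_M, _ -> E i <= 1))%N _.
    by move=> i _; case: (E i).
  by rewrite sum_nat_const card_ord muln1.
rewrite -{1}[M]muln1 leq_mul2l; apply/orP; right.
rewrite (bigD1 (Ordinal xM)) //= (bigD1 (Ordinal nM)) //= prednK // Ax /=.
suff -> : A (a + t ^ k * x + (t * n) ^ k)%N by rewrite -addnA leq_addr.
by rewrite expnMn -addnA -mulnDr.
Qed.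

Lemma power_adj_count (k N D n : nat) (U : {set 'I_N}) (A : pred nat) (x : 'I_N) :
  (0 < k)%N -> (forall z, reflect (exists2 u : 'I_N, u \in U & u = z :> nat) (A z)) ->
  (\sum_(d < D) A (x + (d.+1 * n.+1) ^ k) <= #|[set y in U | power_adj k N x y]|)%N.
Proof.
move=> k0 AP.
pose S := [set d : 'I_D | A (x + (d.+1 * n.+1) ^ k)%N].
have -> : (\sum_(d < D) A (x + (d.+1 * n.+1) ^ k) = #|S|)%N.
  by rewrite -sum1_card [RHS]big_mkcond; apply: eq_bigr => d _; rewrite /S inE; case: (A _).
(* The default [x] of [insubd] never arises for [d] in [S]. *)
pose f (d : 'I_D) : 'I_N := insubd x (x + (d.+1 * n.+1) ^ k)%N.
have fE d : d \in S -> f d \in U /\ f d = (x + (d.+1 * n.+1) ^ k)%N :> nat.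
  rewrite /S inE => /AP[u uU eu]; rewrite /f.
  have -> : insubd x (x + (d.+1 * n.+1) ^ k)%N = u.
    by apply: val_inj; rewrite insubdK ?eu // -topredE /= -eu.
  by rewrite eu.
rewrite -(card_in_imset (f := f)) => [|d d' /fE[_ ed] /fE[_ ed'] /(congr1 val) /= e].
  apply: subset_leq_card; apply/fintype.subsetP => y /imsetP[d /fE[fU ed] ->].
  rewrite inE fU /=; apply/asboolP; exists (d.+1 * n.+1)%N; split=> //; by left.
move: e; rewrite ed ed' => /addnI /eqP; rewrite eqn_exp2r // eqn_pmul2r // eqSS.
by move=> /eqP /val_inj.
Qed.

(** Double counting over dilates by [d^k], [1 <= d <= D]: their translates together force many pairs
    in [U], while for fixed [x] and [n] distinct [d] give distinct neighbours of [x], so small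
    degrees would leave too few. *)
Lemma supersaturation (R : realType) (k b : nat) : (0 < k)%N -> (0 < b)%N ->
  exists2 K : nat, (0 < K)%N &
  forall (N D : nat) (U : {set 'I_N}), (K * D ^ k <= N)%N -> (N < b * #|U|)%N ->
    exists2 x, x \in U & (D <= K * #|[set y in U | power_adj k N x y]|)%N.
Proof.
move=> k0 b0.
have [|M M0 HM] := sarkozy R k (4 * b) k0; first by rewrite muln_gt0.
exists (4 * b * M ^ 2)%N; first by rewrite !muln_gt0 b0 M0.
move=> N D U KD NU; set K := (4 * b * M ^ 2)%N in KD *.
apply: contrapT => hno.
have hdeg x : x \in U -> (K * #|[set y in U | power_adj k N x y]| < D)%N.
  by move=> xU; rewrite ltnNge; apply/negP => h; apply: hno; exists x.
pose A z := [exists u : 'I_N, (u \in U) && (u == z :> nat)].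
have AP z : reflect (exists2 u : 'I_N, u \in U & u = z :> nat) (A z).
  apply: (iffP existsP) => [[u /andP[? /eqP ?]]|[u ? ?]]; exists u => //.
  by apply/andP; split=> //; apply/eqP.
have AU (u : 'I_N) : A u = (u \in U).
  by apply/AP/idP => [[v ? /val_inj <-//]|]; exists u.
have A0 z : (N <= z)%N -> A z = false.
  by move=> Nz; apply/AP => -[u _ uz]; have := ltn_ord u; lia.
have sA : (\sum_(x < N) A x = #|U|)%N.
  by rewrite -sum1_card [RHS]big_mkcond; apply: eq_bigr => u _; rewrite AU; case: ifP.
pose T d := (\sum_(i < M) \sum_(n < M) \sum_(x < N) (A x && A (x + (d.+1 * n.+1) ^ k)))%N.
(* [dilate_count] is summed over all starting points. A shift by at most [D^k M] loses at most that
   many elements of [U], which [K D^k <= N] makes affordable. *)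
have step (d : 'I_D) : (4 * b * M * #|U| <= N * M + 4 * b * M * T d + M * N)%N.
  have h1 (i : 'I_M) : (#|U| <= D ^ k * M + \sum_(a < N) A (a + d.+1 ^ k * i))%N.
    rewrite -sA; apply: leq_trans (sum_pred_shift_ge A N (d.+1 ^ k * i)) _.
    by rewrite leq_add2r leq_mul ?leq_exp2r // ltnW.
  have h2 : (M * #|U| <= M * (D ^ k * M) +
      \sum_(a < N) \sum_(i < M) A (a + d.+1 ^ k * i))%N.
    rewrite [X in (_ <= _ + X)%N]exchange_big /= -{1 2}[M]card_ord -!sum_nat_const -big_split.
    by apply: leq_sum => i _; exact: h1.
  have h3 : (4 * b * \sum_(a < N) \sum_(i < M) A (a + d.+1 ^ k * i) <=
      N * M + 4 * b * M * T d)%N.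
    rewrite big_distrr /=.
    apply: leq_trans (leq_sum _ (fun (a : 'I_N) _ => dilate_count k b M A a d.+1 k0 HM)) _.
    rewrite big_split /= sum_nat_const card_ord leq_add2l -big_distrr leq_mul2l.
    apply/orP; right; rewrite exchange_big; apply: leq_sum => i _.
    rewrite exchange_big; apply: leq_sum => n _.
    apply: (sum_shift_le_supp (fun x => A x && A (x + (d.+1 * n.+1) ^ k)%N : nat)).
    by move=> x /A0 ->.
  have h4 : (4 * b * (M * (D ^ k * M)) <= M * N)%N.
    apply: leq_trans (_ : M * (K * D ^ k) <= _)%N; last by rewrite leq_mul2l KD orbT.
    by rewrite /K -mulnn; nia.
  by nia.
have total : (K * \sum_(d < D) T d <= M ^ 2 * (N * D))%N.
  have -> : (\sum_(d < D) T d = \sum_(i < M) \sum_(n < M) \sum_(x < N)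
      \sum_(d < D) (A x && A (x + (d.+1 * n.+1) ^ k)))%N.
    rewrite exchange_big; apply: eq_bigr => i _; rewrite exchange_big; apply: eq_bigr => n _.
    by rewrite exchange_big.
  have -> : (M ^ 2 * (N * D) = \sum_(i < M) \sum_(n < M) \sum_(x < N) D)%N.
    by rewrite !sum_nat_const !card_ord -mulnn -mulnA.
  rewrite big_distrr; apply: leq_sum => i _; rewrite big_distrr; apply: leq_sum => n _.
  rewrite big_distrr; apply: leq_sum => x _ /=.
  have [Ax|/negbTE nAx] := boolP (A x); last by rewrite big1 ?muln0.
  apply: leq_trans (ltnW (hdeg x _)); last by rewrite -AU.
  by rewrite leq_mul2l (power_adj_count k N D n U A x k0 AP) orbT.
have D0 : (0 < D)%N.
  have /card_gt0P[x /hdeg] : (0 < #|U|)%N by case: #|U| NU => //; rewrite muln0.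
  by case: D {KD hno hdeg step total}.
(* Together with [total] the right side is at most [3 D M N], while [N < b |U|] makes the left side
   exceed [4 D M N]. *)
have : (D * (4 * b * M * #|U|) <= D * (2 * (M * N)) + 4 * b * M * \sum_(d < D) T d)%N.
  rewrite -{1 2}[D]card_ord big_distrr -!sum_nat_const -big_split.
  by apply: leq_sum => d _; have := step d => /=; lia.
move: total; rewrite /K; move: (\sum_(d < D) T d)%N => S total.
have : (4 * b * S <= N * D)%N.
  rewrite -(leq_pmul2l (_ : 0 < M ^ 2)%N) ?expn_gt0 ?M0 //.
  by apply: leq_trans total; rewrite leq_eqVlt; apply/orP; left; apply/eqP; ring.
have : (D * M * (4 * N).+1 <= D * M * (4 * b * #|U|))%N.
  by rewrite leq_mul2l; apply/orP; right; lia.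
have DM : (0 < D * M)%N by rewrite muln_gt0 D0.
have E : (D * (4 * b * M * #|U|) = D * M * (4 * b * #|U|))%N by ring.
rewrite E => h1 h2 h3.
have h4 : (M * (4 * b * S) <= M * (N * D))%N by rewrite leq_mul2l h2 orbT.
have E2 : (4 * b * M * S = M * (4 * b * S))%N by ring.
have E3 : (D * (2 * (M * N)) = 2 * (D * M * N))%N by ring.
have E4 : (M * (N * D) = D * M * N)%N by ring.
have E5 : (D * M * (4 * N).+1 = 4 * (D * M * N) + D * M)%N by ring.
by rewrite E2 E3 E4 E5 in h1 h3 h4 *; lia.
Qed.

(** * The independence polynomial of a graph *)

Definition independent (V : finType) (e : rel V) (I : {set V}) : bool :=
  [forall x in I, forall y in I, ~~ e x y].

Lemma bernoulli_inequality (R : realFieldType) (s : R) (n : nat) :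
  0 <= s -> 1 + n%:R * s <= (1 + s) ^+ n.
Proof.
move=> s0; elim: n => [|n IH]; first by rewrite mul0r addr0 expr0.
rewrite exprS -natr1; have : (0 : R) <= n%:R by [].
by move: IH; move: (_ ^+ n) n%:R => u v; nra.
Qed.

Lemma prod_sum_subsets (R : comNzRingType) (V : finType) (F G : V -> R) :
  \prod_i (F i + G i) =
    \sum_(J : {set V}) \prod_i (if i \in J then F i else G i).
Proof. by rewrite bigA_distr; apply: eq_bigl. Qed.

Lemma sum_powerset (R : comNzRingType) (V : finType) (U : {set V}) (a : R) :
  \sum_(I : {set V} | I \subset U) a ^+ #|I| = (1 + a) ^+ #|U|.
Proof.
have E := prod_sum_subsets R V (fun i : V => if i \in U then a else 0) (fun _ => 1).
transitivity (\prod_(i : V) ((if i \in U then a else 0) + 1)).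
  rewrite E [RHS](bigID (fun I : {set V} => I \subset U)) /= [X in _ + X]big1 ?addr0.
    apply: eq_bigr => I IU.
    rewrite -big_mkcond /= -prodr_const; apply: eq_bigr => i /(fintype.subsetP IU) -> //.
  move=> I /subsetPn[i iI iU].
  by rewrite (bigD1 i) //= iI (negbTE iU) mul0r.
rewrite (bigID (mem U)) /= [X in _ * X]big1 ?mulr1 => [|i /negbTE ->]; last by rewrite add0r.
by rewrite -prodr_const; apply: eq_bigr => i ->; rewrite addrC.
Qed.

(** Expand a product whose second summand is 0 on [I]: only supersets of [I] survive. *)
Lemma sum_supersets (R : comNzRingType) (V : finType) (I : {set V}) (a b : R) :
  \sum_(B : {set V} | I \subset B) a ^+ #|B| * b ^+ #|~: B| =
    a ^+ #|I| * (a + b) ^+ #|~: I|.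
Proof.
have E := prod_sum_subsets R V (fun i : V => a) (fun i => if i \in I then 0 else b).
transitivity (\prod_(i : V) (a + (if i \in I then 0 else b))).
  rewrite E [RHS](bigID (fun B : {set V} => I \subset B)) /= [X in _ + X]big1 ?addr0.
    apply: eq_bigr => B IB.
    rewrite (bigID (mem B)) /= -!prodr_const; congr (_ * _).
      by apply: eq_bigr => i ->.
    apply: eq_big => [i|i]; first by rewrite finset.in_setC.
    rewrite finset.in_setC => /negbTE nB; rewrite nB.
    by case: ifP => // /(fintype.subsetP IB); rewrite nB.
  move=> B /subsetPn[i iI iB].
  by rewrite (bigD1 i) //= iI (negbTE iB) mul0r.
rewrite (bigID (mem I)) /= -!prodr_const; congr (_ * _).
  by apply: eq_bigr => i ->; rewrite addr0.
by apply: eq_big => [i|i /negbTE ->] //; rewrite finset.in_setC.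
Qed.

Section IndependencePolynomial.
Variables (R : realType) (V : finType) (e : rel V) (lam : R).
Hypotheses (lam0 : 0 <= lam) (e_irr : forall x, ~~ e x x).

Definition indep_poly (U : {set V}) : R :=
  \sum_(I : {set V} | (I \subset U) && independent V e I) lam ^+ #|I|.

(** Split by membership of [v]: an independent set containing [v], once [v] is removed, avoids the
    neighbours of [v]. *)
Lemma indep_poly_delete (U : {set V}) (v : V) : v \in U ->
  indep_poly U <= indep_poly (U :\ v) +
    lam * indep_poly ((U :\ v) :\: [set y in U | e v y]).
Proof.
move=> vU; rewrite /indep_poly (bigID (fun I : {set V} => v \in I)) /= addrC; apply: lerD.
  rewrite le_eqVlt; apply/orP; left; apply/eqP; apply: eq_bigl => I.
  by rewrite finset.subsetD1; case: (_ \subset _); case: (_ \in _); case: (independent _ _ _).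
rewrite (reindex_onto (fun J => v |: J) (fun I => I :\ v)) /=; last first.
  by move=> I /andP[_ vI]; rewrite finset.setD1K.
rewrite mulr_sumr big_mkcond [leRHS]big_mkcond; apply: ler_sum => J _ /=.
case: ifPn => [|_]; last by case: ifP => // _; rewrite mulr_ge0 ?exprn_ge0.
case/andP=> /andP[/andP[sU ind] _] /eqP vJ.
have nvJ : v \notin J by rewrite -vJ finset.setD11.
rewrite cardsU1 nvJ exprS; case: ifPn => // /negP[]; apply/andP; split.
  apply/fintype.subsetP => x xJ; rewrite !inE.
  have xU : x \in U by apply: (fintype.subsetP sU); rewrite !inE xJ orbT.
  rewrite xU andbT (_ : x != v) ?andbT; last by apply: contraNneq nvJ => <-.
  move/forall_inP: ind => /(_ v (finset.setU11 _ _)) /forall_inP; apply.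
  by rewrite !inE xJ orbT.
apply/forall_inP => x xJ; apply/forall_inP => y yJ.
move/forall_inP: ind => /(_ x) H; have /forall_inP := H (finset.setU1r _ xJ).
by apply; exact: finset.setU1r.
Qed.

(** While [|U| > m], delete a vertex of degree at least [D]; the recursion closes because
    [1 + lam / (1 + s)^D <= 1 + s]. Once [|U| <= m], all subsets are counted, giving
    [(1 + lam)^m]. *)
Lemma indep_poly_le (s : R) (m D : nat) : 0 <= s -> lam <= s * (1 + s) ^+ D ->
  (forall U : {set V}, (m < #|U|)%N ->
     exists2 x, x \in U & (D <= #|[set y in U | e x y]|)%N) ->
  forall U, indep_poly U <= (1 + lam) ^+ m * (1 + s) ^+ #|U|.
Proof.
move=> s0 lams H U; have [r] := ubnP #|U|; elim: r U => // r IH U Ur.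
have s1 : 1 <= 1 + s by rewrite lerDl.
have l1 : 1 <= 1 + lam by rewrite lerDl.
have [Um|Um] := leqP #|U| m.
  apply: (@le_trans _ _ ((1 + lam) ^+ #|U|)).
    rewrite -sum_powerset /indep_poly [leLHS]big_mkcond [leRHS]big_mkcond.
    apply: ler_sum => I _; case: (_ \subset _) => //=; case: ifP => // _.
    exact: exprn_ge0.
  apply: (@le_trans _ _ ((1 + lam) ^+ m)); first by rewrite ler_weXn2l.
  by rewrite ler_peMr ?exprn_ege1 // exprn_ge0 // (le_trans _ l1).
have [v vU dv] := H U Um.
apply: le_trans (indep_poly_delete U v vU) _.
have cU := cardsD1 v U; rewrite vU /= add1n in cU.
set W := U :\ v in cU *; set Nv := [set y in U | e v y] in dv *.
have NW : Nv \subset W.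
  apply/fintype.subsetP => y; rewrite !inE => /andP[yU evy]; rewrite yU andbT.
  by apply: contraTneq evy => ->; exact: e_irr.
have cW : #|W :\: Nv| = (#|W| - #|Nv|)%N by rewrite cardsD (finset.setIidPr NW).
have DW : (D <= #|W|)%N by apply: leq_trans dv (subset_leq_card NW).
have h1 : indep_poly W <= (1 + lam) ^+ m * (1 + s) ^+ #|W| by apply: IH; lia.
have h2 : indep_poly (W :\: Nv) <= (1 + lam) ^+ m * (1 + s) ^+ (#|W| - D).
  apply: le_trans (IH _ _) _; first by lia.
  rewrite ler_wpM2l ?exprn_ge0 ?(le_trans _ l1) // ler_weXn2l // cW.
  by rewrite leq_sub2l.
have L0 : 0 <= (1 + lam) ^+ m by rewrite exprn_ge0 ?(le_trans _ l1).
have S0 : 0 <= (1 + s) ^+ (#|W| - D) by rewrite exprn_ge0 ?(le_trans _ s1).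
have eW : (1 + s) ^+ #|W| = (1 + s) ^+ (#|W| - D) * (1 + s) ^+ D.
  by rewrite -exprD subnK.
rewrite cU exprS; rewrite eW in h1 *.
apply: (le_trans (lerD h1 (ler_wpM2l lam0 h2))).
move: ((1 + lam) ^+ m) ((1 + s) ^+ (#|W| - D)) ((1 + s) ^+ D) lams L0 S0.
move=> a b c lams a0 b0.
have : a * b * lam <= a * b * (s * c) by rewrite ler_wpM2l ?mulr_ge0.
by lra.
Qed.

End IndependencePolynomial.

(* The first moment of [sum_(I subset W independent) y^|I| / 2^|W|] for the
   [p]-random subset [W]; by [indep_poly_le] it is exponentially small. *)
Lemma random_indep_sum (R : realType) (V : finType) (e : rel V) (p y : R) :
  0 < p <= 1 -> 0 <= y ->
  \sum_(B : {set V}) p ^+ #|B| * (1 - p) ^+ #|~: B| *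
      (2^-1 ^+ #|B| * \sum_(I : {set V} | (I \subset B) && independent V e I) y ^+ #|I|)
    <= (1 - p / 2) ^+ #|V| * indep_poly R V e (p * y) [set: V].
Proof.
move=> /andP[p0 p1] y0.
under eq_bigr do rewrite mulr_sumr mulr_sumr.
rewrite (exchange_big_dep (fun I : {set V} => independent V e I)) /=; last first.
  by move=> B I _ /andP[].
rewrite mulr_sumr; under [leRHS]eq_bigl do rewrite finset.subsetT /=.
apply: ler_sum => I ind.
(* Over the supersets [B] of [I], elements of [I] contribute [p / 2] each and all others
   [p / 2 + (1 - p)]. *)
have -> : \sum_(B : {set V} | (I \subset B) && independent V e I)
    p ^+ #|B| * (1 - p) ^+ #|~: B| * (2^-1 ^+ #|B| * y ^+ #|I|) =
  y ^+ #|I| * ((p / 2) ^+ #|I| * (1 - p / 2) ^+ #|~: I|).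
  have -> : 1 - p / 2 = p / 2 + (1 - p) by field.
  rewrite -sum_supersets mulr_sumr; apply: eq_big => [B|B _]; first by rewrite ind andbT.
  by rewrite exprMn; ring.
rewrite -(cardsC I) exprD [(p * y) ^+ _]exprMn.
(* Since [p <= 1], [1 / 2 <= 1 - p / 2]; this completes the exponent of [1 - p / 2] to [#|V|]. *)
have : 2^-1 ^+ #|I| <= (1 - p / 2) ^+ #|I| by apply: lerXn2r; rewrite ?nnegrE; lra.
have q0 : 0 <= (1 - p / 2) ^+ #|~: I| by apply: exprn_ge0; lra.
have y1 : 0 <= y ^+ #|I| by exact: exprn_ge0.
have p2 : 0 <= p ^+ #|I| by apply: exprn_ge0; lra.
rewrite exprMn; move: (2^-1 ^+ _) ((1 - p / 2) ^+ #|I|) => u v uv.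
have -> : y ^+ #|I| * (p ^+ #|I| * u * (1 - p / 2) ^+ #|~: I|) =
   (y ^+ #|I| * p ^+ #|I| * (1 - p / 2) ^+ #|~: I|) * u by ring.
have -> : v * (1 - p / 2) ^+ #|~: I| * (p ^+ #|I| * y ^+ #|I|) =
   (y ^+ #|I| * p ^+ #|I| * (1 - p / 2) ^+ #|~: I|) * v by ring.
by rewrite ler_wpM2l // !mulr_ge0.
Qed.

(** * The law of the random subset *)

Section BernoulliLaw.
Variables (d : measure_display) (T : measurableType d) (R : realType).
Variables (P : probability T R) (N : nat) (p : R) (W : T -> {set 'I_N}).
Hypothesis PW : bernoulli_subset P p W.

Let event (S S' : {set 'I_N}) : set T :=
  [set w | S \subset W w /\ [disjoint S' & W w]%B]%classic.

(** Independence gives directly only the case of empty [S']. In general remove [t] from [S'] and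
    subtract the event in which [t] lies in [W] instead. *)
Lemma bernoulli_event (S S' : {set 'I_N}) : [disjoint S & S'] ->
  measurable (event S S') /\
  P (event S S') = (p ^+ #|S| * (1 - p) ^+ #|S'|)%:E.
Proof.
have [[mE indE] PE] := PW.
have [r] := ubnP #|S'|; elim: r S S' => // r IH S S' S'r dSS'.
have [->|[t tS']] := finset.set_0Vmem S'.
  have -> : event S finset.set0 = (\bigcap_(i in [set` S]) [set w | i \in W w])%classic.
    apply/seteqP; split => w /=.
      by move=> [sS _] i iS; exact: (fintype.subsetP sS).
    move=> H; split; first by apply/fintype.subsetP => i iS; exact: H.
    by rewrite finset.disjoints_subset finset.sub0set.
  split; first by apply: fin_bigcap_measurable => // i _; exact: mE.
  rewrite indE cards0 expr0 mulr1.
  under eq_bigr do rewrite PE.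
  by rewrite prodEFin prodr_const.
have dS : [disjoint S & S' :\ t].
  by apply: disjointWr dSS'; exact: finset.subD1set.
have tS : t \notin S.
  by apply/negP => tS; move: dSS'; rewrite disjoint_subset => /fintype.subsetP/(_ t tS); rewrite inE tS'.
have dtS : [disjoint t |: S & S' :\ t].
  rewrite finset.disjoints_subset; apply/fintype.subsetP => x; rewrite !inE => /orP[->//|xS].
  apply/negP => /andP[_ xS']; move: dSS'; rewrite disjoint_subset.
  by move=> /fintype.subsetP/(_ x xS); rewrite inE xS'.
have cS' := cardsD1 t S'; rewrite tS' add1n in cS'.
have [m1 P1] := IH S (S' :\ t) ltac:(lia) dS.
have [m2 P2] := IH (t |: S) (S' :\ t) ltac:(lia) dtS.
have -> : event S S' = (event S (S' :\ t)%SET `\` event (t |: S)%SET (S' :\ t)%SET)%classic.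
  apply/seteqP; split => w /=.
    move=> [sS sS']; split; first by split=> //; apply: disjointWl sS'; exact: finset.subD1set.
    move=> [/fintype.subsetP/(_ t (finset.setU11 _ _)) tW _].
    by move: sS'; rewrite disjoint_subset => /fintype.subsetP/(_ t tS'); rewrite inE tW.
  move=> [[sS sS'] H]; split=> //; rewrite -(finset.setD1K tS').
  move: sS'; rewrite !finset.disjoints_subset finset.subUset => sS'; rewrite sS' andbT.
  rewrite finset.sub1set finset.in_setC; apply/negP => tW; apply: H; split; last by rewrite finset.disjoints_subset.
  by rewrite finset.subUset finset.sub1set tW.
split; first exact: measurableD.
apply: etrans (measureD m1 m2 _) _.
  by apply: le_lt_trans (probability_le1 P m1) _; rewrite ltry.
have -> : (event S (S' :\ t)%SET `&` event (t |: S)%SET (S' :\ t)%SET)%classic = event (t |: S) (S' :\ t).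
  apply/setIidPr => w [sS sS']; split=> //.
  by apply: fintype.subset_trans sS; exact: finset.subsetUr.
apply: etrans (congr2 (fun u v => u - v)%E P1 P2) _.
rewrite cardsU1 tS cS' -EFinB; congr (_%:E).
by rewrite add1n !exprS; ring.
Qed.

Lemma bernoulli_law (B : {set 'I_N}) :
  measurable [set w | W w = B]%classic /\
  P [set w | W w = B]%classic = (p ^+ #|B| * (1 - p) ^+ #|~: B|)%:E.
Proof.
have -> : [set w | W w = B]%classic = event B (~: B)%SET.
  apply/seteqP; split => w /=.
    by move=> e; rewrite /event /= e; split=> //; rewrite finset.disjoints_subset.
  move=> [h1 h2]; apply/eqP; rewrite finset.eqEsubset h1 andbT.
  by move: h2; rewrite disjoint_sym finset.disjoints_subset finset.setCK.
by apply: bernoulli_event; rewrite finset.disjoints_subset finset.setCK.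
Qed.

(** [W] has finitely many possible values, so the event is a finite union of events [W w = B]; this
    also gives its measurability. *)
Lemma bernoulli_prob_le (bad : pred {set 'I_N}) :
  measurable [set w | bad (W w)]%classic /\
  (P [set w | bad (W w)]%classic <=
    (\sum_(B | bad B) p ^+ #|B| * (1 - p) ^+ #|~: B|)%:E)%E.
Proof.
have -> : [set w | bad (W w)]%classic = \big[setU/set0]_(B | bad B) [set w | W w = B]%classic.
  apply/seteqP; split => w /=.
    by move=> bW; rewrite (bigD1 (W w)) //=; left.
  by elim/big_ind: _ => [//|A B hA hB [/hA|/hB]//|B bB /= ->].
split; first by apply: bigsetU_measurable => B _; exact: (bernoulli_law B).1.
rewrite -sumEFin.
suff [_] : measurable (\big[setU/set0]_(B | bad B) [set w | W w = B]%classic) /\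
  (P (\big[setU/set0]_(B | bad B) [set w | W w = B]%classic) <=
   \sum_(B | bad B) (p ^+ #|B| * (1 - p) ^+ #|~: B|)%:E)%E by [].
elim/big_rec2: _ => [|B y A bB [mA hA]]; first by rewrite measure0.
have [mB PB] := bernoulli_law B.
split; first exact: measurableU.
by apply: (le_trans (measureU2 _ mB mA)); apply: leeD => //; rewrite -PB.
Qed.

End BernoulliLaw.

(** * Choice of parameters and the failure probability *)

(** [p^(2k) N >= c^(2k) N^gam] with [gam = 1 - 2 k theta > 0]; the bound [1 / (2 k)] on [theta]
    comes from here. *)
Lemma powR_scale_ge1 (R : realType) (k : nat) (theta c : R) :
  (0 < k)%N -> 0 < theta < (2 * k%:R)^-1 -> 0 < c ->
  exists N0 : nat, forall (N : nat) (p : R), (N0 <= N)%N ->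
    c * N%:R `^ (- theta) < p -> 1 <= (p ^+ 2) ^+ k * N%:R.
Proof.
move=> k0 /andP[th0 thk] c0.
have kR : (0 : R) < 2 * k%:R by rewrite mulr_gt0 // ltr0n.
pose gam := 1 - theta * (2 * k%:R).
have gam0 : 0 < gam by rewrite subr_gt0 -ltr_pdivlMr // div1r.
pose X := ((c ^+ 2) ^+ k)^-1.
have X0 : 0 < X by rewrite invr_gt0 !exprn_gt0.
exists (Num.truncn (X `^ gam^-1)).+1 => N p N0N cp.
have N0 : (0 : R) < N%:R by rewrite ltr0n; apply: leq_trans N0N.
have XN : X <= N%:R `^ gam.
  have -> : X = (X `^ gam^-1) `^ gam by rewrite -powRrM mulVf ?gt_eqF // powRr1 // ltW.
  apply: ge0_ler_powR; rewrite ?nnegrE ?powR_ge0 // ?ltW //.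
  by apply: lt_le_trans (truncnS_gt _) _; rewrite ler_nat.
have cp0 : 0 <= c * N%:R `^ (- theta) by rewrite mulr_ge0 ?powR_ge0 // ltW.
apply: (@le_trans _ _ (((c * N%:R `^ (- theta)) ^+ 2) ^+ k * N%:R)); last first.
  rewrite ler_wpM2r // -!exprM lerXn2r // ?nnegrE //; last exact: ltW.
  exact: le_trans (ltW cp).
have -> : ((c * N%:R `^ (- theta)) ^+ 2) ^+ k * N%:R = (c ^+ 2) ^+ k * N%:R `^ gam.
  rewrite [(c * _) ^+ 2]exprMn [(c ^+ 2 * _) ^+ k]exprMn -mulrA; congr (_ * _).
  rewrite -exprM -powR_mulrn ?powR_ge0 // -powRrM natrM.
  rewrite -{2}[N%:R](powRr1 (ltW N0)) -powRD; last by apply/implyP => _; rewrite gt_eqF.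
  by congr (_ `^ _); rewrite /gam; ring.
by rewrite -ler_pdivrMl ?mulr1 // !exprn_gt0.
Qed.

(** A set [A] witnessing the failure is independent and [|B| <= a |A|], so its term alone is at
    least [2^|B|]. *)
Lemma bad_weight_ge1 (R : realType) (N k a : nat) (alpha : R) (B : {set 'I_N}) :
  0 < alpha -> 1 <= alpha * a%:R -> ~ power_difference_dense k alpha B ->
  1 <= 2^-1 ^+ #|B| * \sum_(I : {set 'I_N} |
         (I \subset B) && independent _ (power_adj k N) I) ((2 ^ a)%N%:R : R) ^+ #|I|.
Proof.
move=> alpha0 ha /existsNP[A] /not_implyP[AB] /not_implyP[Aal hA].
have indA : independent _ (power_adj k N) A.
  apply/forall_inP => x xA; apply/forall_inP => y yA; apply/asboolP => -[n [n0 xy]].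
  apply: hA; case: xy => [yx|xy]; [exists y, x | exists x, y]; split=> //; exists n; split=> //.
    by rewrite yx PoszD addrC addKr -natz natrX natz.
  by rewrite xy PoszD addrC addKr -natz natrX natz.
have cB : (#|B| <= a * #|A|)%N.
  rewrite -(ler_nat R) natrM.
  have : a%:R * (alpha * #|B|%:R) <= a%:R * #|A|%:R by rewrite ler_wpM2l.
  have : (0 : R) <= #|B|%:R by [].
  by nra.
rewrite exprVn mulrC ler_pdivlMr ?exprn_gt0 // mul1r (bigD1 A) ?AB //=.
apply: (@le_trans _ _ ((2 ^ a)%N%:R ^+ #|A|)).
  by rewrite -!natrX ler_nat -expnM leq_exp2l.
by rewrite lerDl sumr_ge0 // => I _; rewrite exprn_ge0.
Qed.

Lemma max_power_le (K k N : nat) : (0 < K)%N -> (0 < k)%N -> exists2 D : nat,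
  (K * D ^ k <= N)%N & (N < K * D.+1 ^ k)%N.
Proof.
move=> K0 k0; have ex : exists D, (K * D ^ k <= N)%N by exists 0%N; rewrite exp0n // muln0.
have ub D : (K * D ^ k <= N)%N -> (D <= N)%N.
  apply: leq_trans; apply: leq_trans (leq_pmull _ K0).
  by case: D => // D; rewrite -{1}[D.+1]expn1 leq_pexp2l.
case: (ex_maxnP ex ub) => D HD Hmax; exists D => //.
by rewrite ltnNge; apply/negP => /Hmax; rewrite ltnn.
Qed.

(** [N] is about [K D^k], so [p^2 D] is at least about [1 / K]. With [E = D %/ K] this makes
    [(p E)^2] at least about [E / K^2], which is large with [D]. *)
Lemma degree_large (R : realType) (K k N D C : nat) (p : R) :
  (0 < K)%N -> (0 < k)%N -> 0 < p -> (N < K * D.+1 ^ k)%N ->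
  1 <= (p ^+ 2) ^+ k * N%:R -> (K * K ^ 2 * C.+1 ^ 2 <= D)%N ->
  C%:R <= p * (D %/ K)%N%:R.
Proof.
move=> K0 k0 p0 ND pN CD.
have KR : (0 : R) < K%:R by rewrite ltr0n.
set E := (D %/ K)%N.
have DE : (D.+1 <= K * E.+1)%N by rewrite mulnC ltn_ceil.
have CE : (K ^ 2 * C.+1 ^ 2 <= E)%N by rewrite /E leq_divRL // mulnC mulnA.
(* Otherwise [x = p^2 (D + 1)] is at most 1, so [x^k <= x] and [p^(2k) N <= K x < 1]. *)
have h1 : 1 <= K%:R * (p ^+ 2 * D.+1%:R).
  rewrite leNgt; apply/negP => lt.
  have K1 : (1 : R) <= K%:R by rewrite ler1n.
  have x0 : 0 <= p ^+ 2 * D.+1%:R by rewrite mulr_ge0 // sqr_ge0.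
  have x1 : p ^+ 2 * D.+1%:R <= 1 by nra.
  have : (p ^+ 2) ^+ k * N%:R <= K%:R * (p ^+ 2 * D.+1%:R) ^+ k.
    rewrite [(_ * D.+1%:R) ^+ k]exprMn mulrCA ler_wpM2l ?(exprn_ge0, sqr_ge0, ltW p0) //.
    by rewrite -natrX -natrM ler_nat ltnW.
  have : (p ^+ 2 * D.+1%:R) ^+ k <= p ^+ 2 * D.+1%:R.
    by rewrite -[leRHS]expr1 ler_wiXn2l.
  by nra.
have h2 : 1 <= K%:R ^+ 2 * p ^+ 2 * E.+1%:R.
  apply: le_trans h1 _.
  have -> : K%:R ^+ 2 * p ^+ 2 * E.+1%:R = K%:R * (p ^+ 2 * (K * E.+1)%:R) by rewrite natrM; ring.
  by rewrite ler_pM2l // ler_wpM2l ?sqr_ge0 // ler_nat.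
have h3 : (K%:R ^+ 2 * C.+1%:R ^+ 2 : R) <= E.+1%:R.
  by rewrite -!natrX -natrM ler_nat leqW.
have h4 : (C.+1%:R : R) ^+ 2 <= (p * E.+1%:R) ^+ 2.
  have K2 : (0 : R) < K%:R ^+ 2 by rewrite exprn_gt0.
  rewrite -(ler_pM2l K2); apply: le_trans h3 _.
  have -> : K%:R ^+ 2 * (p * E.+1%:R) ^+ 2 = (K%:R ^+ 2 * p ^+ 2 * E.+1%:R) * E.+1%:R by ring.
  by rewrite ler_peMl.
have pE : 0 <= p * E.+1%:R by rewrite mulr_ge0 // ltW.
have {h4} : C.+1%:R <= p * E.+1%:R.
  by move: h4; rewrite ler_pXn2r // nnegrE.
have p1 : p <= 1 \/ 1 <= p by have [|/ltW] := leP p 1; [left|right].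
(* Passing from [E.+1] to [E] costs [p], which the spare unit in [C.+1] covers when [p <= 1]; for
   [p >= 1], [C <= E] is enough. *)
rewrite -![in X in X -> _]natr1; case: p1 => p1; first by lra.
move=> _; apply: (@le_trans _ _ E%:R); last by rewrite ler_peMl.
rewrite ler_nat; apply: leq_trans CE.
apply: leq_trans (leq_pmull _ _); last by rewrite expn_gt0 K0.
by rewrite -mulnn; lia.
Qed.

(** Take [s = p / 8] and [m = |V| %/ (8 Y)] in [indep_poly_le]. With [n = |V|] the three factors
    contribute the exponents [- p n / 2], [p n / 8] and [p n / 8]. *)
Lemma indep_poly_le_expR (R : realType) (V : finType) (e : rel V) (Y D : nat) (p : R) :
  (forall x, ~~ e x x) -> 0 < p <= 1 -> (0 < Y)%N ->
  8 * Y%:R <= 1 + D%:R * (p / 8) ->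
  (forall U : {set V}, (#|V| < 8 * Y * #|U|)%N ->
     exists2 x, x \in U & (D <= #|[set y in U | e x y]|)%N) ->
  (1 - p / 2) ^+ #|V| * indep_poly R V e (p * Y%:R) [set: V] <=
    expR (- (p * #|V|%:R / 4)).
Proof.
move=> e_irr /andP[p0 p1] Y0 hD H.
have YR : (0 : R) < Y%:R by rewrite ltr0n.
have p8 : 0 <= p / 8 by rewrite divr_ge0 // ltW.
have lam0 : 0 <= p * Y%:R by rewrite mulr_ge0 ?ltW.
pose m := (#|V| %/ (8 * Y))%N.
have Y8 : (0 < 8 * Y)%N by rewrite muln_gt0.
have := indep_poly_le R V e (p * Y%:R) lam0 e_irr (p / 8) m D p8 _ _ [set: V].
rewrite cardsT => /(_ _ _)/le_trans h.
have hs : p * Y%:R <= p / 8 * (1 + p / 8) ^+ D.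
  have := bernoulli_inequality R (p / 8) D p8 => hb.
  have -> : p * Y%:R = p / 8 * (8 * Y%:R) by field.
  by rewrite ler_wpM2l // (le_trans hD).
have hU (U : {set V}) : (m < #|U|)%N ->
   exists2 x, x \in U & (D <= #|[set y in U | e x y]|)%N.
  by rewrite /m ltn_divLR // mulnC; exact: H.
have q0 : 0 <= 1 - p / 2 by lra.
have e1 : (1 - p / 2) ^+ #|V| <= expR (#|V|%:R * - (p / 2)).
  by rewrite expRM_natl lerXn2r ?nnegrE ?expR_ge0 // expR_ge1Dx.
have e2 : (1 + p * Y%:R) ^+ m <= expR (#|V|%:R * (p / 8)).
  apply: (@le_trans _ _ (expR (m%:R * (p * Y%:R)))).
    by rewrite expRM_natl lerXn2r ?nnegrE ?expR_ge0 ?addr_ge0 // expR_ge1Dx.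
  rewrite ler_expR.
  have : (m * (8 * Y))%N%:R <= #|V|%:R :> R by rewrite ler_nat leq_trunc_div.
  by rewrite !natrM => hm; nra.
have e3 : (1 + p / 8) ^+ #|V| <= expR (#|V|%:R * (p / 8)).
  by rewrite expRM_natl lerXn2r ?nnegrE ?expR_ge0 ?addr_ge0 // expR_ge1Dx.
have -> : - (p * #|V|%:R / 4) = #|V|%:R * - (p / 2) + (#|V|%:R * (p / 8) + #|V|%:R * (p / 8)).
  by field.
rewrite !expRD; apply: ler_pM => //; first exact: exprn_ge0.
  by rewrite sumr_ge0 // => I _; exact: exprn_ge0.
apply: h => //; apply: ler_pM => //; apply: exprn_ge0; exact: addr_ge0.
Qed.

Local Open Scope classical_set_scope.
Local Open Scope ring_scope.

Theorem theorem5p1 (R : realType) (k : nat) (hk : (0 < k)%N) :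
  exists theta_k : R, 0 < theta_k /\
    forall alpha : R, 0 < alpha ->
    (* delta is the error term o_{k,alpha}(1) *)
    exists delta : nat -> R, delta @ \oo --> (0 : R) /\
      forall theta c : R, 0 < theta < theta_k -> 0 < c ->
      exists N0 : nat, forall N : nat, (N0 <= N)%N ->
      forall p : R, c * N%:R `^ (- theta) < p <= 1 ->
      forall (d : measure_display) (T : measurableType d)
             (P : probability T R) (W : T -> {set 'I_N}),
        bernoulli_subset P p W ->
        `| 1 - fine (P [set w | power_difference_dense k alpha (W w)]) |
          <= delta N.
Proof.
exists (2 * k%:R)^-1; split; first by rewrite invr_gt0 mulr_gt0 // ltr0n.
move=> alpha alpha0.
(* [harmonic N] is [1 / N.+1]. The failure probability is at most [expR (- x)] with [x = p N / 4],
   and [expR x >= x^2 / 2 >= N / 32] since [p^2 N >= 1]; finally [32 / N <= 64 / N.+1]. *)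
exists (fun N => 64 * harmonic N); split.
  by rewrite -[0 in X in _ --> X](mulr0 64); apply: cvgMr; exact: cvg_harmonic.
move=> theta c th c0.
have [N1 hN1] := powR_scale_ge1 R k theta c hk th c0.
pose a := (Num.truncn alpha^-1).+1.
have ha : 1 <= alpha * a%:R.
  by rewrite mulrC -ler_pdivrMr // div1r ltW // truncnS_gt.
pose Y := (2 ^ a)%N.
have Y0 : (0 < Y)%N by rewrite expn_gt0.
have [|K K0 hK] := supersaturation R k (8 * Y) hk; first by rewrite muln_gt0.
(* [p (D %/ K) >= 64 Y] yields the degree condition of [indep_poly_le_expR]; [N2] makes [D] reach
   the threshold in [degree_large]. *)
pose C := (64 * Y)%N.
pose N2 := (K * (K * K ^ 2 * C.+1 ^ 2) ^ k)%N.
exists (maxn 1 (maxn N1 N2)) => N; rewrite !geq_max => /andP[N_gt0 /andP[NN1 NN2]].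
move=> p /andP[cp p1] d T P W PW.
have p0 : 0 < p by apply: le_lt_trans cp; rewrite mulr_ge0 ?powR_ge0 // ltW.
have pN := hN1 N p NN1 cp.
have [D KD ND] := max_power_le K k N K0 hk.
have CD : (K * K ^ 2 * C.+1 ^ 2 <= D)%N.
  have := leq_ltn_trans NN2 ND; rewrite /N2 ltn_pmul2l // ltn_exp2r // ltnS; exact.
have pD := degree_large R K k N D C p K0 hk p0 ND pN CD.
pose bad : pred {set 'I_N} := fun B => `[< ~ power_difference_dense k alpha B >].
have [mbad Pbad] := bernoulli_prob_le d T R P N p W PW bad.
have -> : [set w | power_difference_dense k alpha (W w)] = ~` [set w | bad (W w)].
  apply/seteqP; split => w /=; first by move=> h /asboolP.
  by move=> h; apply: contrapT => h'; apply: h; apply/asboolP.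
rewrite probability_setC // fineB ?fin_num_measure //= opprB addrC subrK.
rewrite ger0_norm ?fine_ge0 //.
apply: (@le_trans _ _ (expR (- (p * N%:R / 4)))).
  rewrite -lee_fin fineK ?fin_num_measure //; apply: le_trans Pbad _; rewrite lee_fin.
  have irr (x : 'I_N) : ~~ power_adj k N x x.
    apply/asboolP => -[n [n0 h]]; have : (0 < n ^ k)%N by rewrite expn_gt0 n0.
    by case: h => /eqP; rewrite -{1}[x : nat]addn0 eqn_add2l eq_sym => /eqP ->.
  have := indep_poly_le_expR R 'I_N (power_adj k N) Y (D %/ K)%N p irr _ Y0 _ _.
  rewrite card_ord p0 p1 => /(_ isT) h.
  apply: le_trans (h _ _); last 2 first.
  - have : (64 * Y%:R : R) <= p * (D %/ K)%N%:R by apply: le_trans pD; rewrite natrM.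
    by lra.
  - move=> U /(hK N D U KD)[x xU hx]; exists x => //.
    by rewrite -(leq_pmul2l K0) (leq_trans _ hx) // mulnC leq_trunc_div.
  have := random_indep_sum R 'I_N (power_adj k N) p Y%:R _ (ler0n _ _).
  rewrite card_ord p0 p1 => /(_ isT); apply: le_trans.
  rewrite big_mkcond; apply: ler_sum => B _.
  have w0 : 0 <= p ^+ #|B| * (1 - p) ^+ #|~: B|%SET.
    by rewrite mulr_ge0 // exprn_ge0 ?subr_ge0 // ltW.
  case: ifPn => [/asboolP hb|_]; first by rewrite ler_peMr // (bad_weight_ge1 R N k a alpha).
  apply: mulr_ge0 => //; apply: mulr_ge0; first by rewrite exprn_ge0 // invr_ge0.
  by apply: sumr_ge0 => I _; exact: exprn_ge0.
have NR : (0 : R) < N%:R by rewrite ltr0n.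
have pN1 : 1 <= p ^+ 2 * N%:R.
  apply: le_trans pN _; rewrite ler_wpM2r // -[leRHS]expr1.
  apply: ler_wiXn2l => //; first exact: sqr_ge0.
  by rewrite expr_le1 // ltW.
rewrite expRN.
set x := p * N%:R / 4.
have x0 : 0 <= x by rewrite divr_ge0 // mulr_ge0 // ltW.
have hx := expR_ge1Dxn 1 x0.
have x2 : N%:R / 32 <= expR x.
  apply: le_trans hx; rewrite /x.
  have -> : (p * N%:R / 4) ^+ 2 / 2`!%:R = (p ^+ 2 * N%:R) * N%:R / 32 :> R.
    by rewrite (_ : 2`! = 2%N) //; field.
  by nra.
apply: (@le_trans _ _ (N%:R / 32)^-1).
  by rewrite lef_pV2 // posrE ?expR_gt0 // divr_gt0.
rewrite /harmonic /= invf_div ler_pdivlMr ?ltr0n // mulrAC ler_pdivrMr //.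
have : (1 : R) <= N%:R by rewrite ler1n.
by rewrite -[N.+1]addn1 natrD; lra.
Qed.
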